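(* The class of recurrent upward run chains and the class of downward run chains on $(S, \preceq)$ are time reversals of each other. Precisely: (i) Let $\boldsymbol{X}$ be a recurrent upward run chain with transition function $P$ and standard invariant function $F(x) = \mathbb{P}_e(T_x \le T_e)$. Then the time-reversed transition function $Q(y,x) = \frac{F(x)}{F(y)} P(x,y)$, $x, y \in S$, is the transition function of a downward run chain, and the standard invariant function $G$ of that downward run chain equals $F$. (ii) Let $\boldsymbol{Y}$ be a downward run chain with transition function $Q$ and standard invariant function $G(x) = \mathbb{P}_e(U_x \le U_e)$. Then the time-reversed transition function $P(x,y) = \frac{G(y)}{G(x)} Q(y,x)$, $x, y \in S$, is the transition function of a recurrent upward run chain, and the standard invariant function $F$ of that upward run chain equals $G$. In both cases, when the chains are positive recurrent, the two chains have the same invariant probability density function, and the same mean return time to each state $x \in S$.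
   Context: $(S, \preceq)$ is a discrete (countable) partially ordered set with a minimum element $e$, such that for every $x \in S$ every chain (totally ordered subset) in $S$ from $e$ to $x$ is finite. An element $y$ covers $x$ if $y$ is a minimal element of $\{t \in S : t \succ x\}$; $A_x = \{y \in S : y \text{ covers } x\}$ and $B_x = \{w \in S : x \text{ covers } w\}$. An upward run chain is a (time-homogeneous, discrete-time) Markov chain $(X_0, X_1, \ldots)$ on $S$ whose transition function $P$ satisfies $P(x,y) > 0$ if and only if $y \in A_x$ or $y = e$. A downward run chain is a Markov chain $(Y_0, Y_1, \ldots)$ on $S$ whose transition function $Q$ satisfies $Q(x,y) > 0$ if and only if either $x = e$ and $y \in S$, or $x \in S - \{e\}$ and $y \in B_x$. $\mathbb{P}_e$ denotes probability given that the chain starts at $e$; $T_x = \min\{n \ge 1 : X_n = x\}$ and $U_x = \min\{n \ge 1 : Y_n = x\}$ are first positive hitting times. The standard invariant function of a recurrent upward run chain is $F(x) = \mathbb{P}_e(T_x \le T_e)$ and of a downward run chain is $G(x) = \mathbb{P}_e(U_x \le U_e)$. *)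

(* Defs.v *)
From mathcomp Require Import all_boot all_order all_algebra.
From mathcomp Require Import all_classical all_reals all_analysis.

Set Implicit Arguments.
Unset Strict Implicit.
Unset Printing Implicit Defensive.

Import Order.TTheory GRing.Theory Num.Theory.

Local Open Scope classical_set_scope.
Local Open Scope ring_scope.

Section Poset.
Context {disp : Order.disp_t} {S : porderType disp}.

Definition minimal_in (A : set S) (m : S) : Prop :=
  A m /\ forall t, A t -> (t <= m)%O -> t = m.

Definition covers (y x : S) : Prop := minimal_in [set t | (x < t)%O] y.

Definition upper_covers (x : S) : set S := [set y | covers y x].
Definition lower_covers (x : S) : set S := [set w | covers x w].

(* A chain from [a] to [b] has [a] as least and [b] as greatest element; it
   need not be saturated. *)
Definition chain_from_to (a b : S) (C : set S) : Prop :=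
  [/\ total_on C (fun x y => (x <= y)%O), C a, C b &
      forall t, C t -> (a <= t)%O /\ (t <= b)%O].

End Poset.

Section MarkovChain.
Context {R : realType} {S : choiceType}.

Definition transition_function (P : S -> S -> R) : Prop :=
  (forall x y, 0 <= P x y) /\
  (forall x, \esum_(y in [set: S]) (P x y)%:E = 1%E).

Definition invariant_pdf (P : S -> S -> R) (f : S -> R) : Prop :=
  [/\ forall x, 0 <= f x,
      \esum_(x in [set: S]) (f x)%:E = 1%E &
      forall y, \esum_(x in [set: S]) (f x * P x y)%:E = (f y)%:E].

Definition time_reversal (F : S -> R) (P : S -> S -> R) : S -> S -> R :=
  fun y x => F x / F y * P x y.

Context {d : measure_display} {T : measurableType d}.

(* A time-homogeneous chain is a process [X] on [T] together with the family
   of laws [Pr s] under which it starts at [s].  The Markov property is the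
   usual identity between elementary conditional probabilities given the whole
   past, multiplied out by the probability of the conditioning event. *)
Record markov_chain (P : S -> S -> R) (Pr : S -> probability T R)
    (X : nat -> T -> S) : Prop := MarkovChain {
  mc_transition : transition_function P ;
  mc_measurable : forall n x, measurable (X n @^-1` [set x]) ;
  mc_start : forall s, Pr s [set w | X 0%N w = s] = 1%E ;
  mc_markov : forall s n (h : nat -> S) y,
    Pr s [set w | (forall k, (k <= n)%N -> X k w = h k) /\ X n.+1 w = y] =
    (Pr s [set w | forall k, (k <= n)%N -> X k w = h k] * (P (h n) y)%:E)%E
}.

(* First positive hitting time; it is [+oo] when [x] is never hit, as the
   infimum of the empty set. *)
Definition hitting_time (X : nat -> T -> S) (x : S) (w : T) : \bar R :=
  ereal_inf [set n%:R%:E | n in [set n : nat | (1 <= n)%N /\ X n w = x]].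

Definition recurrent (Pr : S -> probability T R) (X : nat -> T -> S) : Prop :=
  forall x, Pr x [set w | (hitting_time X x w < +oo)%E] = 1%E.

Definition mean_return_time (Pr : S -> probability T R) (X : nat -> T -> S)
    (x : S) : \bar R :=
  (\int[Pr x]_w hitting_time X x w)%E.

Definition positive_recurrent (Pr : S -> probability T R) (X : nat -> T -> S) :
    Prop :=
  forall x, (mean_return_time Pr X x < +oo)%E.

Definition standard_invariant (e : S) (Pr : S -> probability T R)
    (X : nat -> T -> S) (x : S) : R :=
  fine (Pr e [set w | (hitting_time X x w <= hitting_time X e w)%E]).

End MarkovChain.

Section RunChain.
Context {R : realType} {disp : Order.disp_t} {S : porderType disp}.

Definition upward_transition (e : S) (P : S -> S -> R) : Prop :=
  transition_function P /\
  forall x y, 0 < P x y <-> upper_covers x y \/ y = e.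

Definition downward_transition (e : S) (Q : S -> S -> R) : Prop :=
  transition_function Q /\
  forall x y, 0 < Q x y <-> x = e \/ (x <> e /\ lower_covers x y).

Context {d : measure_display} {T : measurableType d}.

Definition upward_run_chain (e : S) (P : S -> S -> R)
    (Pr : S -> probability T R) (X : nat -> T -> S) : Prop :=
  markov_chain P Pr X /\ upward_transition e P.

Definition downward_run_chain (e : S) (Q : S -> S -> R)
    (Pr : S -> probability T R) (Y : nat -> T -> S) : Prop :=
  markov_chain Q Pr Y /\ downward_transition e Q.

End RunChain.

(* Main.v *)
Require Import Defs.
From mathcomp Require Import all_boot all_order all_algebra.
From mathcomp Require Import all_classical all_reals all_analysis.
From mathcomp Require Import measurable_realfun.
From mathcomp Require Import ring.

Set Implicit Arguments.
Unset Strict Implicit.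
Unset Printing Implicit Defensive.

Import Order.TTheory GRing.Theory Num.Theory.
Local Open Scope classical_set_scope.
Local Open Scope ring_scope.

(** Fix a stochastic matrix [P] and a state [z], and consider the probability
    [taboo P z n u x] of going from [u] to [x] in [n.+1] steps with every
    intermediate state different from [z]. It is a sum over paths, and along a
    path the factors [F w / F v] of the reversed matrix telescope; hence
    ([taboo_reversal])
      [taboo (time_reversal F P) z n x y = F y / F x * taboo P z n y x].
    Everything follows from this identity.

    Take [z = e] and sum over [n]. For the reversed matrix, the expected number
    of visits to [x] in a cycle from [e] is [F x / F e] times the probability
    that [P] leads from [x] to [e], and conversely. So the property
    [cycle_measure e P F] (the measure [F] is positive and counts the visits in
    a cycle, and [e] is reached surely from everywhere) passes from [P] to its
    reversal ([cycle_measure_reversal]); it makes [F] invariant, and therefore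
    the reversal stochastic. Within a cycle a run chain is strictly monotone, so
    that it visits a state at most once, and the probability [F x] of a visit is
    the expected number of visits ([standard_invariant_visits]). It remains to
    see that both kinds of chains have a cycle measure. A recurrent upward chain
    reaches every state along covers, because chains below a state are finite,
    and it returns to [e] from every state so reached. A downward chain reaches
    [e] surely because it cannot descend forever.

    Take now [z = x = y]. The identity says that the return time to [x] has the
    same law for both chains ([return_reversal]), which gives the equality of
    the mean return times, and the recurrence of the upward chain from that of
    the downward chain. The latter is obtained from a minimum principle
    ([superharmonic_ge]) for the probability of hitting [x], as [e] jumps
    directly to [x].

    Finally the mean return time to [e] is the total mass of [F]
    ([mean_return_time_cycle]), which is thus finite under positive recurrence,
    and [F] normalized is an invariant density for both matrices. It is the only
    one because a density [g] invariant for [P] yields the function [g / F],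
    harmonic for the reversal, which has to be constant
    ([harmonic_constant]). *)

(** * Sums of nonnegative families *)

Section Esum.
Local Open Scope ereal_scope.
Context {R : realType}.

Lemma ge0_esumZl (I : choiceType) (D : set I) (c : R) (a : I -> \bar R) :
  (0 <= c)%R -> (forall i, 0 <= a i) ->
  \esum_(i in D) (c%:E * a i) = c%:E * \esum_(i in D) a i.
Proof.
have le_scale (k : R) (b : I -> \bar R) : (0 <= k)%R -> (forall i, 0 <= b i) ->
    \esum_(i in D) (k%:E * b i) <= k%:E * \esum_(i in D) b i.
  move=> k0 b0; apply: ge_ereal_sup => _ [A [finA AD] <-].
  rewrite -ge0_mule_fsumr// lee_wpmul2l ?lee_fin//.
  by apply: esum_ge; exists A.
move=> c0 a0; apply/eqP; rewrite eq_le le_scale//=.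
have [->|cn0] := eqVneq c 0%R.
  by rewrite mul0e esum_ge0// => i _; rewrite mul0e.
have {c0 cn0} c0 : (0 < c)%R by rewrite lt_neqAle eq_sym cn0.
rewrite -lee_pdivlMl//.
apply: le_trans (le_scale _ _ _ _) => [||i]; last first.
- by rewrite mule_ge0// lee_fin ltW.
- by rewrite invr_ge0 ltW.
apply: le_esum => i _.
by rewrite muleA -EFinM mulVf ?gt_eqF// mul1e.
Qed.

Lemma ge0_esumZr (I : choiceType) (D : set I) (c : R) (a : I -> \bar R) :
  (0 <= c)%R -> (forall i, 0 <= a i) ->
  \esum_(i in D) (a i * c%:E) = (\esum_(i in D) a i) * c%:E.
Proof.
by move=> c0 a0; rewrite muleC -ge0_esumZl//; apply: eq_esum => i _; rewrite muleC.
Qed.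

Lemma esumD1 (I : choiceType) (z : I) (a : I -> \bar R) :
  (forall i, 0 <= a i) ->
  \esum_(i in [set: I]) a i = a z + \esum_(i in ~` [set z]) a i.
Proof. by move=> a0; rewrite (esumID [set z])// !setTI esum_set1. Qed.

Lemma esum_exchange (I J : choiceType) (A : set I) (B : set J)
    (a : I -> J -> \bar R) : (forall i j, 0 <= a i j) ->
  \esum_(i in A) \esum_(j in B) a i j = \esum_(j in B) \esum_(i in A) a i j.
Proof.
move=> a0; rewrite (esum_esum (J := fun=> B))// (esum_esum (J := fun=> A))//.
rewrite (reindex_esum (B `*` A) _ (fun k => (k.2, k.1)))//; split => /=.
- by move=> k [].
- by move=> [i1 j1] [i2 j2] _ _ [-> ->].
- by move=> [i j] [Ai Bj]; exists (j, i).
Qed.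

Lemma esum_nat_recl (a : nat -> \bar R) : (forall n, 0 <= a n) ->
  \esum_(n in [set: nat]) a n = a 0%N + \esum_(n in [set: nat]) a n.+1.
Proof.
move=> a0; rewrite (esumD1 0%N)//; congr (_ + _).
apply: reindex_esum; split => /=.
- by [].
- by move=> m n _ _ [].
- by case=> [/(_ erefl)//|n _]; exists n.
Qed.

(** Two nonnegative families with the same finite total cannot be ordered
    unless they coincide. *)
Lemma esum_le_eq (I : choiceType) (a b : I -> \bar R) (i : I) :
  (forall i, 0 <= a i) -> (forall i, a i <= b i) ->
  \esum_(i in [set: I]) b i \is a fin_num ->
  \esum_(i in [set: I]) b i <= \esum_(i in [set: I]) a i -> a i = b i.
Proof.
move=> a0 ab finb ba; have b0 j : 0 <= b j by exact: le_trans (ab j).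
apply/eqP; rewrite eq_le ab/=.
move: finb ba; rewrite (esumD1 i b0) (esumD1 i a0) => finb.
have fb : \esum_(j in ~` [set i]) b j \is a fin_num.
  by move: finb; rewrite fin_numD => /andP[].
move=> ba; rewrite -(leeD2rE _ _ fb); apply: le_trans ba _.
by rewrite leeD2l//; apply: le_esum.
Qed.

End Esum.

(** * Taboo probabilities and harmonic functions *)

Section Taboo.
Local Open Scope ereal_scope.
Context {R : realType} {S : choiceType}.
Implicit Types (P : S -> S -> R) (x y z u : S) (n : nat).

(** Probability of going from [u] to [x] in [n.+1] steps without meeting [z] at
    the [n] intermediate times; the endpoints are unrestricted. *)
Fixpoint taboo P z n u x : \bar R :=
  if n is m.+1 then \esum_(y in ~` [set z]) (taboo P z m u y * (P y x)%:E)
  else (P u x)%:E.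

(** For [u = z], the expected number of visits to [x] in a cycle from [z]; for
    [x = z], the probability of reaching [z] from [u] at a positive time. *)
Definition visits P z u x : \bar R := \esum_(n in [set: nat]) taboo P z n u x.

Section Nonneg.
Variable P : S -> S -> R.
Hypothesis P_ge0 : forall x y, (0 <= P x y)%R.

Lemma taboo_ge0 z n u x : 0 <= taboo P z n u x.
Proof.
elim: n x => [|n IHn] x /=; first by rewrite lee_fin.
by apply: esum_ge0 => y _; rewrite mule_ge0 ?lee_fin.
Qed.

Lemma visits_ge0 z u x : 0 <= visits P z u x.
Proof. by apply: esum_ge0 => n _; exact: taboo_ge0. Qed.

(** Decomposition at the first step, where the definition decomposes at the
    last one. *)
Lemma taboo_left z n u x : taboo P z n.+1 u x =
  \esum_(y in ~` [set z]) ((P u y)%:E * taboo P z n y x).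
Proof.
have t0 := taboo_ge0.
elim: n x => [//|n IHn] x.
transitivity (\esum_(w in ~` [set z]) \esum_(y in ~` [set z])
    ((P u y)%:E * taboo P z n y w * (P w x)%:E)).
  rewrite [LHS]/=; apply: eq_esum => w _; rewrite [X in X * _]IHn.
  by rewrite ge0_esumZr// => y; rewrite mule_ge0 ?lee_fin.
rewrite esum_exchange; last by move=> w y; rewrite !mule_ge0 ?lee_fin.
apply: eq_esum => y _ /=; rewrite -ge0_esumZl//.
  by apply: eq_esum => w _; rewrite muleA.
by move=> w; rewrite mule_ge0 ?lee_fin.
Qed.

Lemma visits_right z u x : visits P z u x =
  (P u x)%:E + \esum_(y in ~` [set z]) (visits P z u y * (P y x)%:E).
Proof.
have t0 := taboo_ge0.
rewrite /visits esum_nat_recl//; congr (_ + _) => /=.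
rewrite esum_exchange; last by move=> n y; rewrite mule_ge0 ?lee_fin.
by apply: eq_esum => y _; rewrite ge0_esumZr.
Qed.

Lemma visits_left z u x : visits P z u x =
  (P u x)%:E + \esum_(y in ~` [set z]) ((P u y)%:E * visits P z y x).
Proof.
have t0 := taboo_ge0.
rewrite /visits esum_nat_recl//; congr (_ + _) => /=.
rewrite (eq_esum (fun n _ => taboo_left z n u x)).
rewrite esum_exchange; last by move=> n y; rewrite mule_ge0 ?lee_fin.
by apply: eq_esum => y _; rewrite ge0_esumZl.
Qed.

(** Minimum principle: until [z] is reached, a superharmonic function decreases
    on average, so its value is at least its value at [z] as soon as [z] is
    reached surely. *)
Lemma superharmonic_ge z (h : S -> R) u : (forall y, (0 <= h y)%R) ->
  (forall y, \esum_(w in [set: S]) (P y w * h w)%:E <= (h y)%:E) ->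
  visits P z u z = 1 -> (h z <= h u)%R.
Proof.
move=> h0 hP uz; have t0 := taboo_ge0.
(* optional stopping at the first visit to [z] or at time [N] *)
have partial N y :
    (h z)%:E * \sum_(0 <= n < N) taboo P z n y z <= (h y)%:E.
  elim: N y => [|N IHN] y; first by rewrite big_geq// mule0 lee_fin.
  apply: le_trans (hP y); rewrite (esumD1 z); last first.
    by move=> w; rewrite lee_fin mulr_ge0.
  rewrite big_nat_recl// ge0_muleDr//; last exact: sume_ge0.
  rewrite -[X in X + _]/((h z * P y z)%:E) mulrC leeD2l//.
  rewrite (eq_bigr _ (fun n _ => taboo_left z n y z)).
  rewrite -esum_sum; last by move=> w n _ _; rewrite mule_ge0 ?lee_fin.
  rewrite -ge0_esumZl//; last first.
    by move=> w; apply: sume_ge0 => n _; rewrite mule_ge0 ?lee_fin.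
  apply: le_esum => w _; rewrite EFinM.
  by rewrite -ge0_sume_distrr// muleCA lee_wpmul2l ?lee_fin.
rewrite -lee_fin -[leLHS]mule1 -uz /visits -nneseries_esumT//.
rewrite -nneseriesZl//; apply: lime_le; first by apply: is_cvg_nneseries => n _ _; rewrite mule_ge0 ?lee_fin.
by apply: nearW => N; rewrite -ge0_sume_distrr.
Qed.

End Nonneg.

Section Stochastic.
Variable P : S -> S -> R.
Hypothesis trP : transition_function P.
Let P_ge0 : forall x y, (0 <= P x y)%R := proj1 trP.

(** A probability average of values lying on one side of [k] equals [k] only if
    every value charged by it equals [k]. *)
Lemma average_extremal x y (k : R) (g : S -> R) :
  (0 <= k)%R -> (forall w, (0 <= g w)%R) ->
  (forall w, (k <= g w)%R) \/ (forall w, (g w <= k)%R) ->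
  \esum_(w in [set: S]) (P x w * g w)%:E = k%:E ->
  (0 < P x y)%R -> g y = k.
Proof.
move=> k0 g0 kg Eg Pxy.
have Ek : \esum_(w in [set: S]) (P x w * k)%:E = k%:E.
  under eq_esum do rewrite EFinM.
  rewrite ge0_esumZr//; last by move=> w; rewrite lee_fin.
  by rewrite (proj2 trP) mul1e.
suff [] : (P x y * k)%:E = (P x y * g y)%:E.
  by move/(mulfI (lt0r_neq0 Pxy)).
case: kg => kg; [|apply/esym].
- apply: (@esum_le_eq _ _ (fun w => (P x w * k)%:E) (fun w => (P x w * g w)%:E)).
  + by move=> w; rewrite lee_fin mulr_ge0.
  + by move=> w; rewrite lee_fin ler_wpM2l.
  + by rewrite Eg.
  + by rewrite Eg Ek.
- apply: (@esum_le_eq _ _ (fun w => (P x w * g w)%:E) (fun w => (P x w * k)%:E)).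
  + by move=> w; rewrite lee_fin mulr_ge0.
  + by move=> w; rewrite lee_fin ler_wpM2l.
  + by rewrite Ek.
  + by rewrite Eg Ek.
Qed.

(** Harmonic functions of a chain that returns surely to a state from which
    everything is reachable are constant. *)
Lemma harmonic_constant z (h : S -> R) : (forall y, (0 <= h y)%R) ->
  (forall y, \esum_(w in [set: S]) (P y w * h w)%:E = (h y)%:E) ->
  (forall y, visits P z y z = 1) -> (forall y, visits P z z y != 0) ->
  forall y, h y = h z.
Proof.
move=> h0 hP hit reach.
have hz_le w : (h z <= h w)%R.
  by apply: superharmonic_ge (hit w) => // y; rewrite hP.
have step y w : h y = h z -> (0 < P y w)%R -> h w = h z.
  move=> hy Pyw; apply: (average_extremal (x := y)) => //; first by left.
  by rewrite hP hy.
suff taboo_step n y : taboo P z n z y != 0 -> h y = h z.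
  move=> y; apply: contrapT => hy; have /eqP := reach y; apply.
  by apply: esum1 => n _; apply: contrapT => /eqP/taboo_step.
elim: n y => [|n IHn] y /=.
  rewrite eqe => Pzy; apply: (step z) => //.
  by rewrite lt_neqAle eq_sym Pzy P_ge0.
move=> tn; apply: contrapT => hy; case/eqP: tn; apply: esum1 => w _.
have [->|tw] := eqVneq (taboo P z n z w) 0; first by rewrite mul0e.
have [->|Pwy] := eqVneq (P w y) 0%R; first by rewrite mule0.
case: hy; apply: (step w); first exact: IHn.
by rewrite lt_neqAle eq_sym Pwy P_ge0.
Qed.

(** If [z] is reached surely from everywhere and jumps directly to [x], then
    [x] is reached surely too: the hitting probability of [x] is superharmonic,
    hence minimal at [z], where the averaging identity forces it to be [1]. *)
Lemma direct_target_hit z x (h : S -> R) :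
  (forall y, (0 <= h y <= 1)%R) -> (forall y, visits P x y x = (h y)%:E) ->
  (forall y, visits P z y z = 1) -> (0 < P z x)%R ->
  forall y, visits P x y x = 1.
Proof.
move=> h01 hE hit Pzx.
have h0 y : (0 <= h y)%R by case/andP: (h01 y).
have h1 y : (h y <= 1)%R by case/andP: (h01 y).
(* [h'] is the hitting probability of [x] that counts time 0; it dominates [h]
   and its averages are the values of [h] *)
pose h' w := if w == x then 1%R else h w.
have h'0 w : (0 <= h' w)%R by rewrite /h'; case: ifP.
have hP y : \esum_(w in [set: S]) (P y w * h' w)%:E = (h y)%:E.
  rewrite (esumD1 x); last by move=> w; rewrite lee_fin mulr_ge0.
  rewrite -hE visits_left// /h' eqxx mulr1; congr (_ + _).
  by apply: eq_esum => w /eqP/negbTE->; rewrite hE.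
have hz_le w : (h z <= h w)%R.
  apply: superharmonic_ge (hit w) => // y; rewrite -[leRHS]hP.
  apply: le_esum => v _; rewrite lee_fin ler_wpM2l// /h'.
  by case: ifP => // _; rewrite h1.
suff hz : (1 <= h z)%R.
  by move=> y; rewrite hE; congr (_%:E); apply/eqP; rewrite eq_le h1 (le_trans hz).
have h'x : h' x = h z.
  apply: (average_extremal (x := z) (g := h')) => //.
  by left => w; rewrite /h'; case: ifP.
by rewrite -h'x /h' eqxx.
Qed.

End Stochastic.
End Taboo.

(** * Reversal of cycles *)

Section Reversal.
Local Open Scope ereal_scope.
Context {R : realType} {S : choiceType}.
Implicit Types (P : S -> S -> R) (F : S -> R) (x y z : S).

(** The first two conditions describe [F] by the cycles of the chain started at
    [e], the last one is recurrence of [e] together with accessibility from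
    everywhere; the last two are exchanged by time reversal. *)
Definition cycle_measure (e : S) P F : Prop :=
  [/\ forall x, (0 < F x)%R, forall x, visits P e e x = (F x)%:E &
      forall x, visits P e x e = 1].

Variables (e : S) (P : S -> S -> R) (F : S -> R).
Hypothesis P_ge0 : forall x y, (0 <= P x y)%R.
Local Notation Q := (time_reversal F P).

Lemma cycle_measure_base : cycle_measure e P F -> F e = 1%R.
Proof. by case=> _ Fe hit; have := hit e; rewrite Fe => -[]. Qed.

Lemma visits_invariant : (forall x, visits P e e x = (F x)%:E) -> F e = 1%R ->
  forall y, \esum_(x in [set: S]) (F x * P x y)%:E = (F y)%:E.
Proof.
move=> FE Fe1 y; have F0 x : (0 <= F x)%R by rewrite -lee_fin -FE visits_ge0.
rewrite (esumD1 e); last by move=> x; rewrite lee_fin mulr_ge0.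
rewrite Fe1 mul1r -FE visits_right//; congr (_ + _).
by apply: eq_esum => x _; rewrite FE.
Qed.

Lemma cycle_measure_invariant : cycle_measure e P F ->
  forall y, \esum_(x in [set: S]) (F x * P x y)%:E = (F y)%:E.
Proof.
move=> cPF; have Fe1 := cycle_measure_base cPF; case: cPF => _ FE _.
exact: visits_invariant.
Qed.

Section Positive.
Hypothesis F_gt0 : forall x, (0 < F x)%R.

Lemma time_reversal_ge0 x y : (0 <= Q x y)%R.
Proof. by rewrite /time_reversal mulr_ge0// divr_ge0// ltW. Qed.

Lemma time_reversal_gt0 x y : (0 < Q x y)%R = (0 < P y x)%R.
Proof. by rewrite /time_reversal pmulr_rgt0// divr_gt0. Qed.

(** Along a path the factors [F w / F v] telescope, so that reading the path
    backwards only leaves the ratio of the values of [F] at its ends. *)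
Lemma taboo_reversal z n x y :
  taboo Q z n x y = (F y / F x)%:E * taboo P z n y x.
Proof.
have t0 := taboo_ge0 P_ge0.
elim: n y => [|n IHn] y; first by rewrite /= /time_reversal EFinM.
rewrite [in RHS]taboo_left// -ge0_esumZl//; first last.
- by move=> w; rewrite mule_ge0 ?lee_fin.
- by rewrite divr_ge0// ltW.
apply: eq_esum => w _; rewrite [X in X * _]IHn muleAC -EFinM.
rewrite muleA -EFinM /time_reversal; congr (_%:E * _).
by field; rewrite !gt_eqF.
Qed.

Lemma visits_reversal z x y :
  visits Q z x y = (F y / F x)%:E * visits P z y x.
Proof.
rewrite /visits -ge0_esumZl//.
- by apply: eq_esum => n _; exact: taboo_reversal.
- by rewrite divr_ge0// ltW.
- by move=> n; exact: taboo_ge0.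
Qed.

Lemma return_reversal n x : taboo Q x n x x = taboo P x n x x.
Proof. by rewrite taboo_reversal divff ?gt_eqF// mul1e. Qed.

End Positive.

(** The number of visits in a cycle and the probability of completing a cycle
    are exchanged by the reversal. *)
Lemma cycle_measure_reversal : cycle_measure e P F -> cycle_measure e Q F.
Proof.
move=> cPF; have Fe1 := cycle_measure_base cPF; case: cPF => F0 FE hit.
split=> // x; rewrite visits_reversal//.
- by rewrite hit Fe1 divr1 mule1.
- by rewrite FE Fe1 -EFinM div1r mulVf// gt_eqF.
Qed.

Lemma time_reversal_transition : cycle_measure e P F -> transition_function Q.
Proof.
move=> cPF; have inv := cycle_measure_invariant cPF; case: cPF => F0 _ _.
split=> [x y|y]; first exact: time_reversal_ge0.
transitivity ((F y)^-1%:E * \esum_(x in [set: S]) (F x * P x y)%:E).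
  rewrite -ge0_esumZl ?invr_ge0 1?ltW//; last first.
    by move=> x; rewrite lee_fin mulr_ge0// ltW.
  apply: eq_esum => x _; rewrite -EFinM /time_reversal; congr _%:E.
  by rewrite mulrCA mulrA.
by rewrite inv -EFinM mulVf// gt_eqF.
Qed.

(** If [g] is invariant for [P] then [g / F] is harmonic for the reversed
    chain, and therefore constant. *)
Lemma invariant_proportional (g : S -> R) : cycle_measure e P F ->
  (forall x, (0 <= g x)%R) ->
  (forall y, \esum_(x in [set: S]) (g x * P x y)%:E = (g y)%:E) ->
  forall y, g y = (g e * F y)%R.
Proof.
move=> cPF g0 inv y; have Fe1 := cycle_measure_base cPF.
have trQ := time_reversal_transition cPF.
have [_ FE hit] := cycle_measure_reversal cPF.
case: cPF => F0 _ _.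
have : (g y / F y = g e / F e)%R.
  apply: (harmonic_constant trQ (h := (fun w => g w / F w)%R) (z := e)) => //.
  - by move=> w; rewrite divr_ge0// ltW.
  - move=> w.
    transitivity ((F w)^-1%:E * \esum_(x in [set: S]) (g x * P x w)%:E).
      rewrite -ge0_esumZl ?invr_ge0 1?ltW//; last first.
        by move=> x; rewrite lee_fin mulr_ge0.
      apply: eq_esum => x _; rewrite -EFinM /time_reversal; congr _%:E.
      by field; rewrite !gt_eqF.
    by rewrite inv -EFinM mulrC.
  - by move=> w; rewrite FE eqe gt_eqF.
by rewrite Fe1 divr1 => <-; rewrite divfK// gt_eqF.
Qed.

Lemma cycle_measure_unique_pdf (M : R) : cycle_measure e P F ->
  \esum_(x in [set: S]) (F x)%:E = M%:E ->
  unique (invariant_pdf P) (fun x => F x / M)%R.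
Proof.
move=> cPF FM; have Fe1 := cycle_measure_base cPF.
have inv := cycle_measure_invariant cPF; have [F0 _ _] := cPF.
have F0E x : 0 <= (F x)%:E by rewrite lee_fin ltW.
have M0 : (0 < M)%R.
  rewrite (lt_le_trans ltr01)// -lee_fin -FM (esumD1 e)// Fe1 leeDl//.
  by apply: esum_ge0.
split; [split=> [x||y]|].
- by rewrite divr_ge0 ?ltW.
- under eq_esum do rewrite EFinM.
  rewrite ge0_esumZr ?invr_ge0 1?ltW// FM.
  by rewrite -EFinM divff// gt_eqF.
- transitivity ((\esum_(x in [set: S]) (F x * P x y)%:E) * M^-1%:E).
    rewrite -ge0_esumZr ?invr_ge0 1?ltW//; last first.
      by move=> x; rewrite lee_fin mulr_ge0// ltW.
    by apply: eq_esum => x _; rewrite -EFinM mulrAC.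
  by rewrite inv.
move=> g [g0 g1 ginv].
have gE := invariant_proportional cPF g0 ginv.
have gM : (g e * M = 1)%R.
  apply: EFin_inj; rewrite -g1 EFinM -FM -ge0_esumZl//.
  by apply: eq_esum => x _; rewrite (gE x).
apply/funext => x; rewrite gE mulrC; congr (_ * _)%R.
by apply: (mulIf (lt0r_neq0 M0)); rewrite mulVf ?gt_eqF.
Qed.

End Reversal.

(** * Markov property *)

Section CountableMeasure.
Local Open Scope ereal_scope.
Context {R : realType} {d : measure_display} {T : measurableType d}.

Lemma measure_countable_bigcup (mu : {measure set T -> \bar R}) (I : choiceType)
    (D : set I) (E : I -> set T) :
  countable [set: I] -> (forall i, measurable (E i)) -> trivIset D E ->
  mu (\bigcup_(i in D) E i) = \esum_(i in D) mu (E i).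
Proof.
move=> /countable_injP[g ginj] mE tE.
have {}ginj i j : g i = g j -> i = j by apply: ginj; rewrite inE.
pose E' n := \bigcup_(i in D `&` g @^-1` [set n]) E i.
have E'g i : D i -> E' (g i) = E i.
  move=> Di; apply/seteqP; split=> [w [j [_ /= /ginj->]]//|w Ew].
  by exists i.
have mE' n : measurable (E' n).
  have [[i Di <-]|nD] := pselect (exists2 i, D i & g i = n).
    by rewrite E'g.
  rewrite [E' n](_ : _ = set0)//; apply/seteqP; split => // w [i [Di gi] _].
  by apply: nD; exists i.
transitivity (mu (\bigcup_(n in g @` D) E' n)).
  congr (mu _); apply/seteqP; split=> w.
    by move=> [i Di Ew]; exists (g i); [exists i|rewrite E'g].
  by move=> [_ [i Di <-]]; rewrite E'g// => Ew; exists i.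
rewrite measure_bigcup//; last first.
  move=> _ _ [i Di <-] [j Dj <-]; rewrite !E'g// => Eij.
  by congr g; exact: tE.
rewrite nneseries_esum// set_mem_set esum_image; last by move=> i j _ _ /ginj.
by apply: eq_esum => i Di; rewrite E'g.
Qed.

Lemma measurable_forall (A : nat -> set T) : (forall k, measurable (A k)) ->
  measurable [set w | forall k, A k w].
Proof.
move=> mA; rewrite (_ : mkset _ = \bigcap_k A k); first exact: bigcapT_measurable.
by apply/seteqP; split=> w Aw k => [_|]; exact: Aw.
Qed.

Lemma measurable_implies (p : Prop) (A : set T) : measurable A ->
  measurable [set w | p -> A w].
Proof.
move=> mA; have [hp|np] := pselect p.
  by rewrite (_ : mkset _ = A)//; apply/seteqP; split=> w //= /(_ hp).
by rewrite (_ : mkset _ = setT)//; apply/seteqP; split=> w // _ /np.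
Qed.

Lemma probability_setI1 (mu : probability T R) (A B : set T) :
  measurable A -> measurable B -> mu B = 1 -> mu (A `&` B) = mu A.
Proof.
move=> mA mB B1; apply/eqP; rewrite eq_le; apply/andP; split.
  by apply: le_measure; rewrite ?inE//; exact: measurableI.
have AB0 : mu (A `\` B) = 0.
  apply/eqP; rewrite eq_le measure_ge0 andbT.
  have <- : mu (~` B) = 0 by rewrite probability_setC// B1 subee.
  by apply: le_measure; rewrite ?inE//; [exact: measurableD|exact: measurableC].
have -> : mu A = mu (A `\` B) + mu (A `&` B) by exact: measureDI.
by rewrite AB0 add0e.
Qed.

End CountableMeasure.

Section Chain.
Local Open Scope ereal_scope.
Context {R : realType} {S : choiceType}.
Context {d : measure_display} {T : measurableType d}.
Variables (P : S -> S -> R) (Pr : S -> probability T R) (X : nat -> T -> S).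
Hypothesis S_countable : countable [set: S].
Hypothesis mcX : markov_chain P Pr X.
Implicit Types (s x y z : S) (n : nat) (A B : set T).

Let P_ge0 x y : (0 <= P x y)%R := proj1 (mc_transition mcX) x y.

Lemma measurable_state n x : measurable (X n @^-1` [set x]).
Proof. exact: (mc_measurable mcX). Qed.
Hint Resolve measurable_state : core.

Definition past n (h : nat -> S) : set T :=
  [set w | forall k, (k <= n)%N -> X k w = h k].

Lemma measurable_past n h : measurable (past n h).
Proof. by apply: measurable_forall => k; apply: measurable_implies; exact: measurable_state. Qed.
Hint Resolve measurable_past : core.

Lemma total_probability s n A : measurable A ->
  Pr s A = \esum_(x in [set: S]) Pr s (A `&` X n @^-1` [set x]).
Proof.
move=> mA; rewrite -measure_countable_bigcup//.
- by congr (Pr s _); apply/seteqP; split=> [w Aw|w [x _ []//]]; exists (X n w).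
- by move=> x; apply: measurableI.
- by move=> x y _ _ [w [[_ /= <-] [_ /= <-]]].
Qed.

(** A proportionality between the probabilities of two events may be checked on
    each of the countably many possible pasts. *)
Lemma past_proportional s n A B (c : R) : (0 <= c)%R ->
  measurable A -> measurable B ->
  (forall h, Pr s (A `&` past n h) = Pr s (B `&` past n h) * c%:E) ->
  Pr s A = Pr s B * c%:E.
Proof.
move=> c0 mA mB; elim: n => [|n IHn] AB.
  rewrite (total_probability s 0 mA) (total_probability s 0 mB) -ge0_esumZr//.
  apply: eq_esum => x _.
  have -> : X 0 @^-1` [set x] = past 0 (fun=> x); last exact: AB.
  by apply/seteqP; split=> w => [Xw k|/(_ 0%N erefl)//]; rewrite leqn0 => /eqP->.
apply: IHn => h.
have mAh := measurableI _ _ mA (measurable_past n h).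
have mBh := measurableI _ _ mB (measurable_past n h).
rewrite (total_probability s n.+1 mAh) (total_probability s n.+1 mBh) -ge0_esumZr//.
apply: eq_esum => x _; pose h' k := if (k <= n)%N then h k else x.
have pastS : past n h `&` X n.+1 @^-1` [set x] = past n.+1 h'.
  apply/seteqP; split=> [w [hw Xw] k|w h'w].
    by rewrite leq_eqVlt /h' => /orP[/eqP->|kn]; rewrite ?ltnn// -ltnS kn hw.
  split=> [k kn|]; first by rewrite h'w ?leqW// /h' kn.
  by rewrite /= h'w// /h' ltnn.
by rewrite -!setIA pastS.
Qed.

Definition past_determined n A : Prop :=
  forall w w', (forall k, (k <= n)%N -> X k w = X k w') -> A w -> A w'.

(** The Markov property for an arbitrary event of the past, rather than for a
    single history. *)
Lemma markov_past s n A x y : measurable A -> past_determined n A ->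
  A `<=` X n @^-1` [set x] ->
  Pr s (A `&` X n.+1 @^-1` [set y]) = Pr s A * (P x y)%:E.
Proof.
move=> mA detA Ax; apply: (past_proportional (n := n)) => //.
  exact: measurableI.
move=> h; have [[w [Aw hw]]|noA] := pselect (A `&` past n h !=set0).
  have hA : past n h `<=` A.
    by move=> w' hw'; apply: detA Aw => k kn; rewrite hw// hw'.
  have hx : h n = x by rewrite -(hw n)//; exact: Ax.
  rewrite setIAC.
  have -> : A `&` past n h = past n h by apply/setIidr.
  by rewrite -hx -(mc_markov mcX).
have AI0 : A `&` past n h = set0.
  by apply/seteqP; split=> // w Aw; apply: noA; exists w.
by rewrite setIAC AI0 set0I measure0 mul0e.
Qed.

(** Time 0 is exempted, so that a chain started at [z] may avoid [z]. *)
Definition avoids z n : set T :=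
  [set w | forall k, (0 < k <= n)%N -> X k w <> z].

Definition arrives z n x : set T := avoids z n `&` X n.+1 @^-1` [set x].

Lemma measurable_avoids z n : measurable (avoids z n).
Proof.
apply: measurable_forall => k; apply: measurable_implies.
exact: measurableC (measurable_state k z).
Qed.
Hint Resolve measurable_avoids : core.

Lemma measurable_arrives z n x : measurable (arrives z n x).
Proof. exact: measurableI. Qed.
Hint Resolve measurable_arrives : core.

Lemma avoidsS z n : avoids z n.+1 = avoids z n `&` ~` (X n.+1 @^-1` [set z]).
Proof.
apply/seteqP; split=> [w zw|w [zw /= nz] k /andP[k0]].
  split=> [k /andP[k0 kn]|]; first by apply: zw; rewrite k0 leqW.
  by apply: zw; rewrite ltnS leqnn.
rewrite leq_eqVlt => /orP[/eqP->//|kn]; apply: zw.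
by rewrite k0.
Qed.

Lemma avoids_bigcup z n :
  avoids z n.+1 = \bigcup_(y in ~` [set z]) arrives z n y.
Proof.
rewrite avoidsS; apply/seteqP; split=> [w [zw nz]|w [y yz [zw /= yw]]].
  by exists (X n.+1 w).
by split=> //=; rewrite yw.
Qed.

Lemma probability_arrives s z n x : Pr s (arrives z n x) = taboo P z n s x.
Proof.
elim: n x => [|n IHn] x /=.
  pose A := X 0 @^-1` [set s].
  have mA : measurable A by exact: measurable_state.
  have Ps1 : Pr s A = 1 by exact: (mc_start mcX).
  have -> : arrives z 0 x = X 1 @^-1` [set x].
    by apply/seteqP; split=> [w []//|w Xw]; split=> // k; case: k.
  rewrite -(probability_setI1 _ mA)// setIC (@markov_past _ _ _ s)//.
    by rewrite -[X in X * _]/(Pr s A) Ps1 mul1e.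
  by move=> w w' /(_ 0%N erefl) ww'; rewrite /A /= ww'.
have -> : arrives z n.+1 x =
    \bigcup_(y in ~` [set z]) (arrives z n y `&` X n.+2 @^-1` [set x]).
  by rewrite -setI_bigcupl -avoids_bigcup.
rewrite measure_countable_bigcup//; last 2 first.
- by move=> y; apply: measurableI.
- by move=> y y' _ _ [w [[[_ /= <-] _] [[_ /= <-] _]]].
apply: eq_esum => y _; rewrite -IHn; apply: markov_past => //.
  move=> w w' ww' [zw yw]; split=> [k /andP[k0 kn]|]; last by rewrite /= -ww'.
  by rewrite -ww' ?leqW//; apply: zw; rewrite k0.
by move=> w [].
Qed.

Lemma probability_avoids s z n : Pr s (avoids z n.+1) =
  \esum_(y in ~` [set z]) taboo P z n s y.
Proof.
rewrite avoids_bigcup measure_countable_bigcup//.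
  by apply: eq_esum => y _; exact: probability_arrives.
by move=> y y' _ _ [w [[_ /= <-] [_ /= <-]]].
Qed.

Lemma probability_avoids_step s z n :
  Pr s (avoids z n) = Pr s (avoids z n.+1) + taboo P z n s z.
Proof.
rewrite -probability_arrives avoidsS -measureU//.
- by rewrite -setIUr setUC setUv setIT.
- by apply: measurableI => //; exact: measurableC.
- by rewrite /arrives setIACA setICl setI0.
Qed.

Definition hits z : set T := [set w | exists n, X n.+1 w = z].

Lemma hits_bigcup z : hits z = \bigcup_n arrives z n z.
Proof.
apply/seteqP; split=> [w hw|w [n _ [_ nz]]]; last by exists n.
have ex : exists n, `[< X n.+1 w = z >] by case: hw => n /asboolP; exists n.
case: (ex_minnP ex) => n /asboolP nz nmin; exists n => //; split=> // -[//|k] /= kn.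
by move=> /asboolP/nmin; rewrite leqNgt kn.
Qed.

Lemma measurable_hits z : measurable (hits z).
Proof. by rewrite hits_bigcup; exact: bigcupT_measurable. Qed.
Hint Resolve measurable_hits : core.

Lemma trivIset_arrives z : trivIset setT (fun n => arrives z n z).
Proof.
move=> m n _ _ [w [[zm Xm] [zn Xn]]].
by have [mn|nm|//] := ltngtP m n; [case: (zn m.+1)|case: (zm n.+1)].
Qed.

Lemma probability_hits s z : Pr s (hits z) = visits P z s z.
Proof.
rewrite hits_bigcup measure_countable_bigcup//.
- by apply: eq_esum => n _; exact: probability_arrives.
- exact: countableP.
- exact: trivIset_arrives.
Qed.

End Chain.

(** * Hitting times *)

Section HittingTime.
Local Open Scope ereal_scope.
Context {R : realType} {S : choiceType} {d : measure_display}
  {T : measurableType d}.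
Variable X : nat -> T -> S.
Implicit Types (x y z : S) (n : nat) (w : T).
Local Notation tau := (hitting_time (R := R) X).

Lemma hitting_time_hits z w : (tau z w < +oo) <-> hits X z w.
Proof.
split=> [|[n nz]]; last first.
  rewrite (@le_lt_trans _ _ (n.+1%:R%:E))// ?ltry//.
  by apply: ereal_inf_lbound; exists n.+1.
apply: contraPP => nh; rewrite /hitting_time [X in ereal_inf X](_ : _ = set0).
  by rewrite ereal_inf0 ltxx.
apply/seteqP; split => // _ [[|n] [//= _ nz] _].
by apply: nh; exists n.
Qed.

Lemma hitting_time_avoids z w n : (n.+1%:R%:E <= tau z w) <-> avoids X z n w.
Proof.
split=> [le_n k /andP[k0 kn] kz|av].
  have : tau z w <= k%:R%:E by apply: ereal_inf_lbound; exists k.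
  by move=> /(le_trans le_n); rewrite lee_fin ler_nat ltnNge kn.
apply: le_ereal_inf_tmp => _ [k [k1 kz] <-]; rewrite lee_fin ler_nat ltnNge.
by apply/negP => kn; apply: (av k); rewrite ?k1.
Qed.

Lemma hitting_time_arrives z w n : arrives X z n z w -> tau z w = n.+1%:R%:E.
Proof.
move=> [av nz]; apply/eqP; rewrite eq_le; apply/andP; split.
  by apply: ereal_inf_lbound; exists n.+1.
exact/hitting_time_avoids.
Qed.

Lemma not_hits_avoids z w n : ~ hits X z w -> avoids X z n w.
Proof. by move=> nh [|k] //= _ kz; apply: nh; exists k. Qed.

(** Tail-sum formula. *)
Lemma hitting_time_sum z w :
  tau z w = \sum_(n <oo) (\1_(avoids X z n) w)%:E.
Proof.
have [hw|nh] := pselect (hits X z w).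
  move: hw; rewrite hits_bigcup => -[n _ nz].
  rewrite (hitting_time_arrives nz) (nneseries_split 0 n.+1)//.
  rewrite add0n [X in _ + X]eseries0 ?adde0; last first.
    move=> k nk _; rewrite indicE memNset// => av.
    by case: nz => _; apply: av.
  rewrite (eq_big_nat _ _ (F2 := fun=> 1)).
    by rewrite sumEFin big_const_nat iter_addr addr0 subn0.
  move=> k /andP[_ kn]; rewrite indicE mem_set// => j /andP[j0 jk].
  by case: nz => av _; apply: av; rewrite j0 (leq_trans jk).
have -> : tau z w = +oo.
  apply/eqP; rewrite -leye_eq leNgt; apply/negP => /hitting_time_hits.
  exact: nh.
apply/esym/eq_infty => r.
apply: (@le_trans _ _ (\sum_(0 <= n < (Num.truncn `|r|).+1) (\1_(avoids X z n) w)%:E)).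
  rewrite (eq_bigr (fun=> 1)); last first.
    by move=> n _; rewrite indicE mem_set//; exact: not_hits_avoids.
  rewrite sumEFin big_const_nat iter_addr addr0 subn0 lee_fin.
  by rewrite (le_trans (ler_norm r))// ltW// truncnS_gt.
by apply: nneseries_lim_ge => n _; rewrite lee_fin.
Qed.

(** When [x] is hit by time [tau e], either it is reached at some time before
    which [e] was avoided, or both hitting times are infinite. *)
Lemma hitting_time_le e x :
  [set w | tau x w <= tau e w] =
  \bigcup_n arrives X e n x `|` (~` hits X e `&` ~` hits X x).
Proof.
apply/seteqP; split=> [w /= le_xe|w [[n _ [av nx]]|[ne nx]]] /=.
- have [hx|nx] := pselect (hits X x w).
    left; move: hx; rewrite hits_bigcup => -[n _ nx]; exists n => //.
    split; last by case: nx.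
    by apply/hitting_time_avoids; rewrite -(hitting_time_arrives nx).
  right; split=> //= /hitting_time_hits/(le_lt_trans le_xe).
  by move/hitting_time_hits.
- apply: (@le_trans _ _ (n.+1%:R%:E)); last exact/hitting_time_avoids.
  by apply: ereal_inf_lbound; exists n.+1.
- have -> : tau e w = +oo; last exact: leey.
  by apply/eqP; rewrite -leye_eq leNgt; apply/negP => /hitting_time_hits.
Qed.

End HittingTime.

Section ChainHitting.
Local Open Scope ereal_scope.
Context {R : realType} {S : choiceType}.
Context {d : measure_display} {T : measurableType d}.
Variables (P : S -> S -> R) (Pr : S -> probability T R) (X : nat -> T -> S).
Hypothesis S_countable : countable [set: S].
Hypothesis mcX : markov_chain P Pr X.
Implicit Types (s x y z : S) (n : nat) (A B : set T).

Let P_ge0 x y : (0 <= P x y)%R := proj1 (mc_transition mcX) x y.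

Lemma recurrentP : recurrent Pr X <-> forall x, visits P x x x = 1.
Proof.
have hitsE x : [set w | hitting_time X x w < (+oo : \bar R)] = hits X x.
  by apply/seteqP; split=> w; move/(hitting_time_hits (R := R)).
split=> [rec x|vis x].
  by rewrite -(probability_hits S_countable mcX) -hitsE; exact: rec.
by rewrite hitsE (probability_hits S_countable mcX).
Qed.

Lemma mean_return_timeE x :
  mean_return_time Pr X x = \esum_(n in [set: nat]) Pr x (avoids X x n).
Proof.
rewrite /mean_return_time; under eq_integral do rewrite hitting_time_sum.
rewrite integral_nneseries//.
- rewrite nneseries_esumT; last first.
    by move=> n; apply: integral_ge0 => w _; rewrite lee_fin.
  apply: eq_esum => n _; rewrite integral_indic//; first by rewrite setIT.
  exact: (measurable_avoids mcX).
- move=> n; apply/measurable_EFinP/measurable_indic.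
  exact: (measurable_avoids mcX).
Qed.

(** Kac's formula: the mean length of a cycle is the total number of visits
    that it makes. *)
Lemma mean_return_time_cycle e F : cycle_measure e P F ->
  mean_return_time Pr X e = \esum_(x in [set: S]) (F x)%:E.
Proof.
move=> cPF; have Fe1 := cycle_measure_base cPF; case: cPF => F0 FE _.
rewrite mean_return_timeE esum_nat_recl// (esumD1 e); last first.
  by move=> x; rewrite lee_fin ltW.
rewrite Fe1; congr (_ + _).
  rewrite (_ : avoids X e 0 = setT) ?probability_setT//.
  by apply/seteqP; split => // w _ [].
under eq_esum do rewrite (probability_avoids S_countable mcX).
rewrite esum_exchange; last by move=> n y; exact: taboo_ge0.
by apply: eq_esum => y _; exact: FE.
Qed.

Definition admissible : set T := [set w | forall k, (0 < P (X k w) (X k.+1 w))%R].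

Let forbidden k : set T := [set w | ~ (0 < P (X k w) (X k.+1 w))%R].

Let measurable_forbidden k : measurable (forbidden k).
Proof.
rewrite (_ : forbidden k = \bigcup_x \bigcup_y ([set w | ~ (0 < P x y)%R] `&`
    (X k @^-1` [set x] `&` X k.+1 @^-1` [set y]))); last first.
  apply/seteqP; split=> [w nw|w [x _ [y _ [nxy [/= xk yk]]]]].
    by exists (X k w) => //; exists (X k.+1 w).
  by rewrite /forbidden /= xk yk.
apply: countable_bigcupT_measurable => // x.
apply: countable_bigcupT_measurable => // y.
have mxy := measurableI _ _ (measurable_state mcX k x) (measurable_state mcX k.+1 y).
have [Pxy|Pxy] := pselect (0 < P x y)%R.
  by rewrite (_ : mkset _ = set0) ?set0I//; apply/seteqP; split=> // w [].
by rewrite (_ : mkset _ = setT) ?setTI//; apply/seteqP; split.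
Qed.

Lemma measurable_admissible : measurable admissible.
Proof.
apply: measurable_forall => k; have := measurableC (measurable_forbidden k).
by congr measurable; apply/seteqP; split => w /= => [/contrapT|w0 /(_ w0)].
Qed.

(** A step from [x] to [y] with [P x y = 0] has probability zero at each of
    the countably many times, for each of the countably many pairs. *)
Lemma probability_admissible s : Pr s admissible = 1.
Proof.
have forbidden0 k : Pr s (forbidden k) = 0.
  rewrite (total_probability S_countable mcX s k)//; apply: esum1 => x _.
  have mfx := measurableI _ _ (measurable_forbidden k) (measurable_state mcX k x).
  rewrite (total_probability S_countable mcX s k.+1)//; apply: esum1 => y _.
  have [Pxy|Pxy] := boolP (0 < P x y)%R.
    rewrite (_ : _ `&` _ = set0) ?measure0//; apply/seteqP; split=> // w.
    by move=> [[nf /= xk] /= yk]; apply: nf; rewrite xk yk.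
  apply/eqP; rewrite eq_le measure_ge0 andbT.
  have Pxy0 : P x y = 0%R.
    by apply/eqP; move: Pxy; rewrite lt_neqAle P_ge0 andbT eq_sym negbK.
  have detX : past_determined X k (X k @^-1` [set x]).
    by move=> w w' ww'; rewrite /= ww'.
  have <- : Pr s (X k @^-1` [set x] `&` X k.+1 @^-1` [set y]) = 0.
    rewrite (@markov_past _ _ _ _ _ _ _ S_countable mcX s k _ x y _ detX)//; last first.
      exact: (measurable_state mcX).
    by rewrite Pxy0 mule0.
  apply: le_measure; rewrite ?inE//.
  - by apply: measurableI => //; exact: (measurable_state mcX).
  - by apply: measurableI; exact: (measurable_state mcX).
  - by move=> w [[_ ?] ?].
have mU := bigcupT_measurable _ measurable_forbidden.
have -> : admissible = ~` \bigcup_k forbidden k.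
  apply/seteqP; split=> [w adm [k _]|w nf k]; first by apply; exact: adm.
  by apply: contrapT => nk; apply: nf; exists k.
rewrite probability_setC// (_ : Pr s _ = 0) ?sube0//.
apply/negligibleP => //; apply: negligible_bigcup => k.
by apply/(negligibleP _ (measurable_forbidden k))/forbidden0.
Qed.

End ChainHitting.

(** * Visits within a cycle *)

Section CycleVisits.
Local Open Scope ereal_scope.
Context {R : realType} {S : choiceType}.
Context {d : measure_display} {T : measurableType d}.
Variables (P : S -> S -> R) (Pr : S -> probability T R) (X : nat -> T -> S).
Hypothesis S_countable : countable [set: S].
Hypothesis mcX : markov_chain P Pr X.
Variables (e : S) (r : S -> S -> Prop).
Hypothesis r_irr : forall x, ~ r x x.
Hypothesis r_trans : forall x y z, r x y -> r y z -> r x z.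
Hypothesis P_mono : forall x y, x <> e -> y <> e -> (0 < P x y)%R -> r x y.

Lemma excursion_monotone w m n : admissible P X w -> (m < n)%N ->
  (forall k, (m <= k <= n)%N -> X k w <> e) -> r (X m w) (X n w).
Proof.
move=> adm; elim: n => // n IHn; rewrite ltnS => mn nonbase.
have rn : r (X n w) (X n.+1 w).
  by apply: P_mono => //; apply: nonbase; rewrite ?mn ?leqnn ?leqW.
move: mn; rewrite leq_eqVlt => /orP[/eqP->//|mn].
apply: r_trans rn; apply: IHn => // k /andP[mk kn].
by apply: nonbase; rewrite mk leqW.
Qed.

(** Within a cycle the chain moves strictly along [r], so that it visits [x] at
    most once: the probability of a visit is the expected number of visits. *)
Lemma standard_invariant_visits x : visits P e e e = 1 ->
  visits P e e x = (standard_invariant e Pr X x)%:E.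
Proof.
move=> vis1; rewrite /standard_invariant hitting_time_le.
set V := \bigcup_n _; set A := V `|` _.
have mV : measurable V.
  by apply: bigcupT_measurable => n; exact: (measurable_arrives mcX).
have mh z : measurable (hits X z) := measurable_hits mcX z.
have mA : measurable A.
  by apply: measurableU => //; apply: measurableI; exact: measurableC.
have hits1 : Pr e (hits X e) = 1 by rewrite (probability_hits S_countable mcX).
have adm1 := probability_admissible S_countable mcX e.
have madm := measurable_admissible S_countable mcX.
suff -> : visits P e e x = Pr e A by rewrite fineK// fin_num_measure.
(* [e] is hit almost surely, which discards the trajectories on which both
   hitting times are infinite *)
rewrite -(probability_setI1 mA (mh e) hits1).
have -> : A `&` hits X e = V `&` hits X e.
  by apply/seteqP; split=> [w [[Vw|[nw _]] hw]|w [Vw hw]] => //; split=> //; left.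
rewrite (probability_setI1 mV (mh e) hits1) -(probability_setI1 mV madm adm1).
rewrite setI_bigcupl measure_countable_bigcup.
- apply: eq_esum => n _.
  rewrite -(probability_arrives S_countable mcX); apply/esym/probability_setI1 => //.
  exact: (measurable_arrives mcX).
- exact: countableP.
- by move=> n; apply: measurableI => //; exact: (measurable_arrives mcX).
(* between two visits to [x] in the same cycle there would be [r x x] *)
have once w m n : arrives X e m x w -> arrives X e n x w -> admissible P X w ->
    ~ (m < n)%N.
  move=> [_ mx] [ne nx] adm mn.
  apply: (@r_irr x); rewrite -[X in r X _]mx -[X in r _ X]nx.
  apply: excursion_monotone => // k /andP[mk]; rewrite leq_eqVlt => /orP[/eqP->|kn].
    by rewrite nx -mx; apply: ne; rewrite mn.
  by apply: ne; rewrite (leq_trans _ mk).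
move=> m n _ _ [w [[mw adm] [nw _]]].
by have [mn|nm|//] := ltngtP m n; [case: (once w m n)|case: (once w n m)].
Qed.

End CycleVisits.

(** The probability of a first return at time [n.+1] is [taboo P x n x x], so
    these numbers determine the law of the return time. *)
Lemma mean_return_time_eq (R : realType) (S : choiceType)
    (d d' : measure_display) (T : measurableType d) (T' : measurableType d')
    (P Q : S -> S -> R) (Pr : S -> probability T R) (Pr' : S -> probability T' R)
    (X : nat -> T -> S) (Y : nat -> T' -> S) (x : S) :
  countable [set: S] -> markov_chain P Pr X -> markov_chain Q Pr' Y ->
  (forall n, taboo P x n x x = taboo Q x n x x) ->
  mean_return_time Pr X x = mean_return_time Pr' Y x.
Proof.
move=> S_countable mcX mcY PQ.
rewrite (mean_return_timeE mcX) (mean_return_timeE mcY); apply: eq_esum => n _.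
elim: n => [|n IHn].
  rewrite (_ : avoids X x 0 = setT); last by apply/seteqP; split => // w _ [].
  rewrite (_ : avoids Y x 0 = setT); last by apply/seteqP; split => // w _ [].
  by rewrite !probability_setT.
have tfin : taboo P x n x x \is a fin_num.
  rewrite -(probability_arrives S_countable mcX); apply: fin_num_measure.
  exact: (measurable_arrives mcX).
move: IHn; rewrite (probability_avoids_step S_countable mcX).
rewrite (probability_avoids_step S_countable mcY) -PQ.
by move=> /(congr1 (fun t => t - taboo P x n x x)%E); rewrite !addeK.
Qed.

(** Kac's formula turns positive recurrence of either chain at [e] into the
    finiteness of the mass of [F], the normalizing constant of both densities. *)
Lemma reversal_invariants (R : realType) (S : choiceType) (e : S)
    (d d' : measure_display) (T : measurableType d) (T' : measurableType d')
    (P : S -> S -> R) (F : S -> R)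
    (Pr : S -> probability T R) (Pr' : S -> probability T' R)
    (X : nat -> T -> S) (Y : nat -> T' -> S) :
  countable [set: S] -> cycle_measure e P F ->
  markov_chain P Pr X -> markov_chain (time_reversal F P) Pr' Y ->
  positive_recurrent Pr X \/ positive_recurrent Pr' Y ->
  (exists f : S -> R,
    unique (invariant_pdf P) f /\ unique (invariant_pdf (time_reversal F P)) f) /\
  (forall x, mean_return_time Pr X x = mean_return_time Pr' Y x).
Proof.
move=> S_countable cPF mcX mcY pos; have P_ge0 := proj1 (mc_transition mcX).
have cQF := cycle_measure_reversal P_ge0 cPF.
have Q_ge0 := proj1 (mc_transition mcY).
have mXY x : mean_return_time Pr X x = mean_return_time Pr' Y x.
  apply: (mean_return_time_eq S_countable mcX mcY) => n.
  by rewrite return_reversal//; case: cPF.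
split=> //.
have : (\esum_(x in [set: S]) (F x)%:E < +oo)%E.
  rewrite -(mean_return_time_cycle S_countable mcX cPF).
  by case: pos => pos; [|rewrite mXY]; exact: pos.
rewrite -ge0_fin_numE; last first.
  by apply: esum_ge0 => x _; rewrite lee_fin ltW//; case: cPF.
move=> /fineK/esym sumF; exists (fun x => F x / fine (\esum_(x in [set: S]) (F x)%:E)).
by split; [exact: (cycle_measure_unique_pdf P_ge0 cPF sumF)
          |exact: (cycle_measure_unique_pdf Q_ge0 cQF sumF)].
Qed.

(** * Posets with finite chains below each element *)

Section FiniteChains.
Context {disp : Order.disp_t} {S : porderType disp} (e : S).
Hypothesis e_minimum : forall x : S, (e <= x)%O.
Hypothesis S_chains :
  forall (x : S) (C : set S), chain_from_to e x C -> finite_set C.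

Lemma no_infinite_chain (s : nat -> S) x : injective s ->
  (forall m n, (s m <= s n)%O \/ (s n <= s m)%O) -> ~ (forall n, (s n <= x)%O).
Proof.
move=> s_inj s_total sx; pose C := range s `|` [set e; x].
have : finite_set C.
  apply: (S_chains (x := x)); split.
  - move=> _ _ [[m _ <-]|[->|->]] [[n _ <-]|[->|->]];
      by [exact: s_total|left; rewrite ?e_minimum ?lexx|right; rewrite ?e_minimum|].
  - by right; left.
  - by right; right.
  - by move=> _ [[n _ <-]|[->|->]]; split; rewrite ?e_minimum ?lexx.
rewrite finite_setU => -[+ _].
rewrite (eq_finite_set (inj_card_eq _)); first exact: infinite_nat.
by move=> m n _ _ /s_inj.
Qed.

Lemma no_ascent (s : nat -> S) x :
  (forall n, (s n < s n.+1)%O) -> ~ (forall n, (s n <= x)%O).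
Proof.
move=> s_lt; have s_mono : {homo s : m n / (m < n)%N >-> (m < n)%O}.
  by apply: homo_ltn s_lt => y x' z; exact: lt_trans.
apply: no_infinite_chain => [m n mn|m n].
  have [/s_mono|/s_mono|//] := ltngtP m n; by rewrite mn ltxx.
have [/s_mono/ltW|/s_mono/ltW|->] := ltngtP m n; [by left|by right|by left].
Qed.

Lemma no_descent (s : nat -> S) : ~ (forall n, (s n.+1 < s n)%O).
Proof.
move=> s_lt; have s_mono m n : (m < n)%N -> (s n < s m)%O.
  by apply: (homo_ltn (r := fun x y => (y < x)%O)) => // y x' z xy /lt_trans; apply.
apply: (@no_infinite_chain s (s 0%N)) => [m n mn|m n|n].
- have [/s_mono|/s_mono|//] := ltngtP m n; by rewrite mn ltxx.
- have [/s_mono/ltW|/s_mono/ltW|->] := ltngtP m n; [by right|by left|by left].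
- by case: n => // n; exact/ltW/s_mono.
Qed.

(** Otherwise every element below [x] would lie strictly below another one, and
    there would be an infinite ascent from [e] to [x]. *)
Lemma exists_lower_cover x : x <> e -> exists w, covers x w.
Proof.
move=> xe; apply: contrapT => ncov.
have step (w : {w | (w < x)%O}) : {t : {t | (t < x)%O} | (sval w < sval t)%O}.
  apply: cid; apply: contrapT => nt; apply: ncov; exists (sval w).
  split=> [|t /= wt tx]; first exact: svalP w.
  apply: contrapT => /eqP tnx; apply: nt.
  have tltx : (t < x)%O by rewrite lt_neqAle tnx.
  by exists (exist _ t tltx).
have ex : (e < x)%O by rewrite lt_neqAle e_minimum andbT; apply/eqP => /esym.
have [s [_ s_asc]] := dependent_choice step (exist _ e ex).
apply: (@no_ascent (fun n => sval (s n)) x) s_asc _ => n.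
exact/ltW/(svalP (s n)).
Qed.

(** Induction along covers: a counterexample would have a lower cover that is
    again a counterexample, and so start an infinite descent. *)
Lemma cover_ind (K : S -> Prop) : K e ->
  (forall w y, covers y w -> K w -> K y) -> forall x, K x.
Proof.
move=> Ke Kcov x; apply: contrapT => nKx.
have step (y : {y | ~ K y}) : {w : {w | ~ K w} | (sval w < sval y)%O}.
  apply: cid; have ye : sval y <> e by move=> ye; apply: (svalP y); rewrite ye.
  have [w yw] := exists_lower_cover ye.
  have nKw : ~ K w by move=> /(Kcov _ _ yw); exact: svalP y.
  by exists (exist _ w nKw); case: yw.
have [s [_ s_desc]] := dependent_choice step (exist _ x nKx).
exact: (@no_descent (fun n => sval (s n))) s_desc.
Qed.

End FiniteChains.

(** * Upward and downward run chains *)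

Section RunChains.
Context {R : realType} {disp : Order.disp_t} {S : porderType disp} (e : S).
Hypothesis S_countable : countable [set: S].
Hypothesis e_minimum : forall x : S, (e <= x)%O.
Hypothesis S_chains :
  forall (x : S) (C : set S), chain_from_to e x C -> finite_set C.

Lemma covers_lt (x y : S) : covers x y -> (y < x)%O.
Proof. by case. Qed.

Lemma upward_reversal_support (P : S -> S -> R) (F : S -> R) :
  (forall x, 0 < F x) -> upward_transition e P ->
  forall x y, 0 < time_reversal F P x y <-> x = e \/ (x <> e /\ lower_covers x y).
Proof.
move=> F0 [_ supp] x y; rewrite time_reversal_gt0//; split=> [/supp|].
  have [->|/eqP xe] := eqVneq x e; first by left.
  by move=> [|//]; right.
by move=> [->|[xe xy]]; apply/supp; [right|left].
Qed.

Lemma downward_reversal_support (Q : S -> S -> R) (G : S -> R) :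
  (forall x, 0 < G x) -> downward_transition e Q ->
  forall x y, 0 < time_reversal G Q x y <-> upper_covers x y \/ y = e.
Proof.
move=> G0 [_ supp] x y; rewrite time_reversal_gt0//; split=> [/supp|].
  by move=> [|[_ ?]]; [right|left].
have [->|/eqP ye] := eqVneq y e; first by move=> _; apply/supp; left.
by move=> [xy|//]; apply/supp; right.
Qed.

Section Upward.
Context {d : measure_display} {T : measurableType d}.
Variables (P : S -> S -> R) (Pr : S -> probability T R) (X : nat -> T -> S).
Hypothesis upX : upward_run_chain e P Pr X.
Let mcX : markov_chain P Pr X := proj1 upX.
Let trP : transition_function P := mc_transition mcX.
Let P_ge0 : forall x y, 0 <= P x y := proj1 trP.

Lemma upward_standard_invariant x : visits P e e e = 1%E ->
  visits P e e x = (standard_invariant e Pr X x)%:E.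
Proof.
apply: (standard_invariant_visits S_countable mcX (r := fun x y => (x < y)%O)).
- by move=> y; rewrite ltxx.
- by move=> y z w; exact: lt_trans.
- by move=> y z _ ze /(proj2 (proj2 upX)) [/covers_lt|].
Qed.

(** Positivity and sure return propagate from [e] along covers, each of which is
    a transition of positive probability. *)
Lemma upward_cycle_measure :
  recurrent Pr X -> cycle_measure e P (standard_invariant e Pr X).
Proof.
move=> /(recurrentP S_countable mcX) rec.
have FE x := upward_standard_invariant x (rec e).
have Fe1 : standard_invariant e Pr X e = 1.
  by have := FE e; rewrite rec => -[].
have cover_gt0 w y : covers y w -> 0 < P w y.
  by move=> yw; apply/(proj2 (proj2 upX)); left.
split=> //.
- apply: (cover_ind e_minimum S_chains) => [|w y yw Fw]; first by rewrite Fe1.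
  have F0 z : 0 <= standard_invariant e Pr X z by rewrite -lee_fin -FE visits_ge0.
  rewrite -lte_fin -(visits_invariant P_ge0 FE Fe1) (esumD1 w); last first.
    by move=> z; rewrite lee_fin mulr_ge0.
  apply: (@lt_le_trans _ _ (standard_invariant e Pr X w * P w y)%:E).
    by rewrite lte_fin mulr_gt0// cover_gt0.
  by rewrite leeDl//; apply: esum_ge0 => z _; rewrite lee_fin mulr_ge0.
- pose h x := fine (Pr x (hits X e)).
  have hE x : visits P e x e = (h x)%:E.
    by rewrite -(probability_hits S_countable mcX) /h fineK// fin_num_measure//;
      exact: (measurable_hits mcX).
  have h0 x : 0 <= h x by rewrite -lee_fin -hE visits_ge0.
  have h1 x : h x <= 1.
    rewrite -lee_fin -hE -(probability_hits S_countable mcX) probability_le1//.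
    exact: (measurable_hits mcX).
  have he1 : h e = 1 by have := hE e; rewrite rec => -[].
  suff hx1 x : h x = 1 by move=> x; rewrite hE hx1.
  move: x; apply: (cover_ind e_minimum S_chains) => // w y yw hw.
  apply: (average_extremal trP (x := w)) => //.
  + by right.
  + rewrite (esumD1 e); last by move=> z; rewrite lee_fin mulr_ge0.
    rewrite he1 mulr1 -hw -hE visits_left//; congr (_ + _)%E.
    by apply: eq_esum => z _; rewrite hE.
  + exact: cover_gt0.
Qed.

End Upward.

Section Downward.
Context {d : measure_display} {T : measurableType d}.
Variables (Q : S -> S -> R) (Pr : S -> probability T R) (Y : nat -> T -> S).
Hypothesis downY : downward_run_chain e Q Pr Y.
Let mcY : markov_chain Q Pr Y := proj1 downY.
Let trQ : transition_function Q := mc_transition mcY.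
Let Q_ge0 : forall x y, 0 <= Q x y := proj1 trQ.

Lemma downward_standard_invariant x : visits Q e e e = 1%E ->
  visits Q e e x = (standard_invariant e Pr Y x)%:E.
Proof.
apply: (standard_invariant_visits S_countable mcY (r := fun x y => (y < x)%O)).
- by move=> y; rewrite ltxx.
- by move=> y z w yz /lt_trans; apply.
- by move=> y z ye _ /(proj2 (proj2 downY)) [//|[_ /covers_lt]].
Qed.

(** A trajectory that never meets [e] would descend forever. *)
Lemma downward_hits s : visits Q e s e = 1%E.
Proof.
rewrite -(probability_hits S_countable mcY); apply/eqP; rewrite eq_le.
have mh := measurable_hits mcY e.
rewrite probability_le1//= -(probability_admissible S_countable mcY s).
apply: le_measure; rewrite ?inE//; first exact: (measurable_admissible S_countable mcY).
move=> w adm; apply: contrapT => nh.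
apply: (@no_descent _ _ _ e_minimum S_chains (fun n => Y n.+1 w)) => n.
have /(proj2 (proj2 downY)) := adm n.+1.
by move=> [ye|[_ /covers_lt//]]; case: nh; exists n.
Qed.

Lemma downward_cycle_measure : cycle_measure e Q (standard_invariant e Pr Y).
Proof.
have GE x := downward_standard_invariant x (downward_hits e).
split=> //; last exact: downward_hits.
move=> x; rewrite -lte_fin -GE visits_right//.
apply: (@lt_le_trans _ _ (Q e x)%:E).
  by rewrite lte_fin; apply/(proj2 (proj2 downY)); left.
by rewrite leeDl//; apply: esum_ge0 => y _; rewrite mule_ge0 ?lee_fin ?visits_ge0.
Qed.

(** Every state is a direct successor of [e], itself reached surely. *)
Lemma downward_recurrent : recurrent Pr Y.
Proof.
apply/(recurrentP S_countable mcY) => x.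
pose h y := fine (Pr y (hits Y x)).
have mh := measurable_hits mcY x.
have hE y : Pr y (hits Y x) = (h y)%:E by rewrite fineK// fin_num_measure.
apply: (direct_target_hit trQ (z := e) (h := h)).
- by move=> y; rewrite -!lee_fin -hE measure_ge0 probability_le1.
- by move=> y; rewrite -(probability_hits S_countable mcY).
- exact: downward_hits.
- by apply/(proj2 (proj2 downY)); left.
Qed.

End Downward.
End RunChains.

Theorem mainTheorem7 (R : realType) (disp : Order.disp_t) (S : porderType disp)
    (e : S)
    (S_countable : countable [set: S])
    (e_minimum : forall x : S, (e <= x)%O)
    (S_chains : forall (x : S) (C : set S), chain_from_to e x C -> finite_set C) :
  (forall (d : measure_display) (T : measurableType d)
      (P : S -> S -> R) (Pr : S -> probability T R) (X : nat -> T -> S),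
    upward_run_chain e P Pr X -> recurrent Pr X ->
    let F := standard_invariant e Pr X in
    let Q := time_reversal F P in
    downward_transition e Q /\
    forall (d' : measure_display) (T' : measurableType d')
        (Pr' : S -> probability T' R) (Y : nat -> T' -> S),
      downward_run_chain e Q Pr' Y ->
      (forall x, standard_invariant e Pr' Y x = F x) /\
      (positive_recurrent Pr X \/ positive_recurrent Pr' Y ->
        (exists f : S -> R,
          unique (invariant_pdf P) f /\ unique (invariant_pdf Q) f) /\
        (forall x, mean_return_time Pr X x = mean_return_time Pr' Y x)))
  /\
  (forall (d : measure_display) (T : measurableType d)
      (Q : S -> S -> R) (Pr : S -> probability T R) (Y : nat -> T -> S),
    downward_run_chain e Q Pr Y ->
    let G := standard_invariant e Pr Y in
    let P := time_reversal G Q in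
    upward_transition e P /\
    forall (d' : measure_display) (T' : measurableType d')
        (Pr' : S -> probability T' R) (X : nat -> T' -> S),
      upward_run_chain e P Pr' X ->
      recurrent Pr' X /\
      (forall x, standard_invariant e Pr' X x = G x) /\
      (positive_recurrent Pr Y \/ positive_recurrent Pr' X ->
        (exists f : S -> R,
          unique (invariant_pdf Q) f /\ unique (invariant_pdf P) f) /\
        (forall x, mean_return_time Pr Y x = mean_return_time Pr' X x))).
Proof.
split=> [d T P Pr X upX recX F Q|d T Q Pr Y downY G P].
- have cPF : cycle_measure e P F.
    exact: (upward_cycle_measure S_countable e_minimum S_chains upX recX).
  have mcX := proj1 upX; have P_ge0 := proj1 (mc_transition mcX).
  have cQF : cycle_measure e Q F by exact: cycle_measure_reversal.
  split.
    split; first exact: (time_reversal_transition P_ge0 cPF).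
    by apply: (upward_reversal_support _ (proj2 upX)); case: cPF.
  move=> d' T' Pr' Y downY; split=> [x|].
    have [_ FE hit] := cQF; apply: EFin_inj.
    by rewrite -FE (downward_standard_invariant S_countable downY).
  exact: (reversal_invariants S_countable cPF mcX (proj1 downY)).
- have cQG : cycle_measure e Q G.
    exact: (downward_cycle_measure S_countable e_minimum S_chains downY).
  have mcY := proj1 downY; have Q_ge0 := proj1 (mc_transition mcY).
  have cPG : cycle_measure e P G by exact: cycle_measure_reversal.
  have G0 : forall x, 0 < G x by case: cQG.
  split.
    split; first exact: (time_reversal_transition Q_ge0 cQG).
    exact: (downward_reversal_support G0 (proj2 downY)).
  move=> d' T' Pr' X upX; split; last split=> [x|].
  + apply/(recurrentP S_countable (proj1 upX)) => x.
    have := downward_recurrent S_countable e_minimum S_chains downY.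
    move=> /(recurrentP S_countable mcY)/(_ x) <-.
    by apply: eq_esum => n _; exact: return_reversal.
  + have [_ GE hit] := cPG; apply: EFin_inj.
    by rewrite -GE (upward_standard_invariant S_countable upX).
  + exact: (reversal_invariants S_countable cQG mcY (proj1 upX)).
Qed.
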